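(* Let $A\in\mathbb{C}^{n\times n}$ be Hermitian with eigenvalues $\lambda_1\ge\cdots\ge\lambda_n$ and associated orthonormal eigenvectors $x_1,\ldots,x_n$. Let $\mathcal{Y}\subseteq\mathbb{C}^n$ be a subspace with $p=\dim\mathcal{Y}\ge1$, let $f$ be a scalar function defined on the eigenvalues of $A$, and let $\mathcal{Y}'=f(A)\mathcal{Y}$. Let $t\in\{p,\ldots,n-1\}$ and $i\in\{1,\ldots,p\}$, and define $\widetilde{\mathcal{X}}=\mathrm{span}\{x_{t-p+i+1},\ldots,x_t\}^{\perp}$ (so $\widetilde{\mathcal{X}}=\mathbb{C}^n$ for $i=p$) and $\widetilde{\mathcal{Y}}=\widetilde{\mathcal{X}}\cap\mathcal{Y}$. Assume that the smallest ($p$th largest) Ritz value $\eta_p$ of $A$ in $\mathcal{Y}$ satisfies $\eta_p>\lambda_{t+1}$, and that $|f(\lambda_1)|\ge\cdots\ge|f(\lambda_t)|>\max_{j\in\{t+1,\ldots,n\}}|f(\lambda_j)|$. Then $\dim\widetilde{\mathcal{Y}}\ge i$, and for every $i$-dimensional subspace $\widetilde{\mathcal{Y}}_i\subseteq\widetilde{\mathcal{Y}}$ the subspace $\widetilde{\mathcal{Y}}'_i=f(A)\widetilde{\mathcal{Y}}_i$ has dimension $i$. Moreover, if $\widetilde{\eta}_i$ and $\widetilde{\eta}'_i$ denote the smallest ($i$th largest) Ritz values in $\widetilde{\mathcal{Y}}_i$ and $\widetilde{\mathcal{Y}}'_i$, then either $\widetilde{\eta}'_i\ge\lambda_{t-p+i}$,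 or $$0<\frac{\lambda_{t-p+i}-\widetilde{\eta}'_i}{\widetilde{\eta}'_i-\lambda_{t+1}}\le\frac{\max_{j\in\{t+1,\ldots,n\}}|f(\lambda_j)|^2}{|f(\lambda_{t-p+i})|^2}\ \frac{\lambda_{t-p+i}-\widetilde{\eta}_i}{\widetilde{\eta}_i-\lambda_{t+1}}.$$ Consequently, $\dim\mathcal{Y}'=p$, and the $i$th largest Ritz value $\eta'_i$ in $\mathcal{Y}'$ satisfies either $\eta'_i\ge\lambda_{t-p+i}$ or $$0<\frac{\lambda_{t-p+i}-\eta'_i}{\eta'_i-\lambda_{t+1}}\le\frac{\max_{j\in\{t+1,\ldots,n\}}|f(\lambda_j)|^2}{|f(\lambda_{t-p+i})|^2}\ \frac{\lambda_{t-p+i}-\eta_p}{\eta_p-\lambda_{t+1}}.$$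
   Context: Eigenvalues are counted with multiplicity and $Ax_j=\lambda_jx_j$. The matrix function is $f(A)=\sum_{j=1}^n f(\lambda_j)x_jx_j^H$, and $f(A)\mathcal{U}=\{f(A)u:u\in\mathcal{U}\}$ for a subspace $\mathcal{U}$. Orthogonality and $\perp$ refer to the Euclidean inner product. For a subspace $\mathcal{U}\subseteq\mathbb{C}^n$ of dimension $d\ge1$ with orthonormal basis matrix $U\in\mathbb{C}^{n\times d}$, the Ritz values of $A$ in $\mathcal{U}$ are the $d$ eigenvalues (with multiplicity) of $U^HAU$; they do not depend on the choice of $U$. They are ordered decreasingly, so the $i$th largest Ritz value is the $i$th in this order. *)

(* Defs.v *)
From HB Require Import structures.
From mathcomp Require Import all_boot all_order all_algebra.
From mathcomp Require Export sesquilinear spectral complex reals.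

Set Implicit Arguments.
Unset Strict Implicit.
Unset Printing Implicit Defensive.

Import Order.TTheory GRing.Theory Num.Theory Num.Def.
Local Open Scope ring_scope.
Local Open Scope sesquilinear_scope.

Section InnerProduct.
Variable C : numClosedFieldType.

(* The trace form of the library, \tr (u *m v ^t* ), is v ^t* *m u on columns. *)
Definition dotcv n (u v : 'cV[C]_n) : C := form_of_matrix conjC 1%:M u v.

HB.instance Definition _ n :=
  Bilinear.copy (@dotcv n) (form_of_matrix conjC 1%:M).
HB.instance Definition _ n :=
  Hermitian.copy (@dotcv n) (form_of_matrix conjC 1%:M).

Lemma dotcvE n (u v : 'cV[C]_n) : dotcv u v = (v ^t* *m u) 0 0.
Proof. by rewrite /dotcv /form_of_matrix mulmx1 mxtrace_mulC trace_mx11. Qed.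

End InnerProduct.

Section Ritz.
Variable C : numClosedFieldType.

Definition mximg n (B : 'M[C]_n) (V : {vspace 'cV[C]_n}) : {vspace 'cV[C]_n} :=
  (linfun (mulmx B : 'cV[C]_n -> 'cV[C]_n) @: V)%VS.

(* All eigenvalues, with algebraic multiplicity; the order on C is only
   partial, but it is total on the (real) spectrum of a Hermitian matrix. *)
Definition eigvals d (B : 'M[C]_d) : seq C :=
  sort >=%R (sval (closed_field_poly_normal (char_poly B))).

Lemma char_poly_eigvals d (B : 'M[C]_d) :
  char_poly B = \prod_(z <- eigvals B) ('X - z%:P).
Proof.
rewrite /eigvals; case: closed_field_poly_normal => r /= hr.
rewrite {1}hr (eqP (char_poly_monic B)) scale1r.
by apply: perm_big; rewrite perm_sym perm_sort.
Qed.

Lemma size_eigvals d (B : 'M[C]_d) : size (eigvals B) = d.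
Proof.
by have := size_char_poly B; rewrite char_poly_eigvals size_prod_XsubC => -[].
Qed.

Definition orthonormal_basis_mx {n d} (V : {vspace 'cV[C]_n}) :=
  [pred U : 'M[C]_(n, d) |
    (U ^t* *m U == 1%:M) && (<<[tuple col j U | j < d]>>%VS == V)].

Lemma ex_orthonormal_basis_mx n (V : {vspace 'cV[C]_n}) :
  exists U : 'M[C]_(n, \dim V), orthonormal_basis_mx V U.
Proof.
have le_dn : (\dim V <= n)%N.
  by have := dimvS (subvf V); rewrite dimvf /dim /= muln1.
pose M : 'M[C]_(\dim V, n) := \matrix_(i < \dim V) ((vbasis V)`_i)^T.
pose S := schmidt M.
have S1 : S *m S ^t* = 1%:M by apply/eqP/schmidt_unitarymx.
have hU : (S^T)^t* *m S^T = 1%:M.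
  by apply: trmx_inj; rewrite trmx_mul trmx1 -[RHS]S1 map_trmx !trmxK.
exists (S^T); apply/andP; split; first exact/eqP.
rewrite eq_sym eqEdim; apply/andP; split; last first.
  by rewrite (leq_trans (dim_span _)) // size_tuple.
rewrite -[X in (X <= _)%VS](span_basis (vbasisP V)); apply/span_subvP=> v.
move=> /(tnthP (vbasis V))[i ->].
have /submxP[D /(congr1 (row i))] : (M <= S)%MS by apply: schmidt_sub.
rewrite rowK row_mul => /(congr1 trmx); rewrite trmxK (tnth_nth 0) => ->.
rewrite mulmx_sum_row linear_sum memv_suml // => k _.
rewrite linearZ memvZ // memv_span //= tr_row; exact: image_f.
Qed.

Definition ritz n (A : 'M[C]_n) (V : {vspace 'cV[C]_n}) : seq C :=
  let U := xchoose (ex_orthonormal_basis_mx V) in eigvals (U ^t* *m A *m U).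

(* The [i]th largest Ritz value, for i in 1..\dim V. *)
Definition ritz_val n (A : 'M[C]_n) (V : {vspace 'cV[C]_n}) (i : nat) : C :=
  (ritz A V)`_i.-1.

Lemma size_ritz n (A : 'M[C]_n) V : size (ritz A V) = \dim V.
Proof. exact: size_eigvals. Qed.

(* Independence of the orthonormal basis. *)
Lemma ritzE n (A : 'M[C]_n) V (U : 'M[C]_(n, \dim V)) :
  orthonormal_basis_mx V U -> ritz A V = eigvals (U ^t* *m A *m U).
Proof.
move=> /andP[/eqP hU /eqP sU]; rewrite /ritz.
move: (xchooseP (ex_orthonormal_basis_mx V)).
set W := xchoose _ => /andP[/eqP hW /eqP sW]; clearbody W.
have [Q hQ] : exists Q, W = U *m Q.
  exists (\matrix_(i, j) coord [tuple col j U | j < \dim V] i (col j W)).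
  apply/matrixP=> a j; rewrite mxE.
  have /coord_span : col j W \in <<[tuple col k U | k < \dim V]>>%VS.
    rewrite sU; have := sW; set T := (<<_>>)%VS => TV.
    have jT : col j W \in T by apply: memv_span; exact: image_f.
    by move: jT; rewrite TV.
  move=> /(congr1 (fun v : 'cV_n => v a 0)); rewrite mxE => ->.
  rewrite summxE; apply: eq_bigr => k _.
  by rewrite -tnth_nth tnth_mktuple !mxE mulrC.
have tQ : W ^t* = Q ^t* *m U ^t* by rewrite hQ trmx_mul map_mxM.
have hQQ : Q ^t* *m Q = 1%:M.
  by rewrite -hW tQ hQ mulmxA -(mulmxA _ _ U) hU mulmx1.
rewrite tQ hQ; congr (sort _ (sval (closed_field_poly_normal _))).
set B := U ^t* *m A *m U.
have -> : Q ^t* *m U ^t* *m A *m (U *m Q) = Q ^t* *m B *m Q.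
  by rewrite !mulmxA.
have hP : map_mx polyC (Q ^t*) *m map_mx polyC Q = 1%:M.
  by rewrite -map_mxM hQQ map_mx1.
rewrite /char_poly; set P := map_mx _ Q in hP *; set P' := map_mx _ _ in hP *.
have -> : char_poly_mx (Q ^t* *m B *m Q) = P' *m char_poly_mx B *m P.
  rewrite /char_poly_mx !map_mxM mulmxBr mulmxBl -/P -/P'; congr (_ - _).
  by rewrite (scalar_mxC _ P') -mulmxA hP mulmx1.
by rewrite !det_mulmx mulrAC -det_mulmx hP det1 mul1r.
Qed.

End Ritz.

(* Main.v *)
Require Import Defs.
From mathcomp Require Import all_boot all_order all_algebra all_fingroup ring zify.

(** Write A = X diag(mu) X^H with X unitary, and put H = f(A) = X diag(g) X^H.
In the coordinates c = X^H v, the shifted quadratic form of A is diagonal,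

  v^H A v - z |v|^2 = sum_k (mu_k - z) |c_k|^2,

and passing from v to H v multiplies the kth term by |g_k|^2.  Hence a bound on
|g_k|^2, from below on the eigenvalues above z and from above on those below z,
compares the form at H v with the form at v (shifted_form_amplified).

Let s = t - p + i, l = lambda_s, l1 = lambda_(t+1), F = |f(l)|, and let m be the
maximum of |f| over the eigenvalues of index greater than t.  The vectors of
Ytilde have no components of indices s+1, ..., t, so each of their components
either has mu_k >= l and |g_k| >= F, or has mu_k <= l1 and |g_k| <= m.  The
comparison then holds both with shift l and factor m^2 and with shift l1 and
factor F^2.  If kap |v|^2 <= v^H A v, and H v has Rayleigh quotient at most eta,
the two comparisons read

  (l - eta) |Hv|^2 <= m^2 (l - kap) |v|^2,
  F^2 (kap - l1) |v|^2 <= (eta - l1) |Hv|^2,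

and their quotient is the inequality of the theorem (gap_ratio_le).

Such a v is found by a dimension count: if W is an i-dimensional subspace of V,
then W contains a nonzero vector whose Rayleigh quotient is at most the ith
largest Ritz value in V (ritz_val_min_le).  Both bounds of the theorem come from
this single statement, filtered_ritz_bound, applied to W = Ytilde_i: with
V = f(A) Ytilde_i and kap the smallest Ritz value in Ytilde_i for the first,
with V = f(A) Y and kap the smallest Ritz value in Y for the second.

Finally, with shift l1 and factor |f(lambda_t)|^2 the comparison holds on all of
Y, where the shifted form is positive since eta_p > l1.  So f(A) kills no nonzero
vector of Y and preserves the dimensions of its subspaces (dim_filtered_image). *)

Set Implicit Arguments.
Unset Strict Implicit.
Unset Printing Implicit Defensive.

Import Order.TTheory GRing.Theory Num.Theory.
Local Open Scope ring_scope.
Local Open Scope sesquilinear_scope.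

(** * Quadratic forms on column vectors *)

Section RitzFilter.
Variable C : numClosedFieldType.

Lemma memv_span_colsP n d (U : 'M[C]_(n, d)) (v : 'cV[C]_n) :
  reflect (exists c : 'cV[C]_d, v = U *m c)
          (v \in <<[tuple col j U | j < d]>>%VS).
Proof.
have mulE c : U *m c = \sum_k c k 0 *: col k U.
  apply/colP=> a; rewrite mxE summxE; apply: eq_bigr => k _.
  by rewrite !mxE mulrC.
apply: (iffP idP) => [/coord_span hv | [c ->]]; last first.
  rewrite mulE memv_suml // => k _; rewrite memvZ // memv_span //.
  exact: image_f.
exists (\col_k coord [tuple col j U | j < d] k v).
rewrite mulE [LHS]hv; apply: eq_bigr => k _.
by rewrite mxE -tnth_nth tnth_mktuple.
Qed.

Lemma adjmxM m n p (M : 'M[C]_(m, n)) (N : 'M[C]_(n, p)) :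
  (M *m N) ^t* = N ^t* *m M ^t*.
Proof. by rewrite trmx_mul map_mxM. Qed.

Lemma dotcv_cols n d (W : 'M[C]_(n, d)) (v : 'cV[C]_n) k :
  (W ^t* *m v) k 0 = dotcv v (col k W).
Proof.
by rewrite dotcvE !mxE; apply: eq_bigr => a _; rewrite !mxE.
Qed.

Lemma dotcv_diag n d (A : 'M[C]_n) (W : 'M[C]_(n, d)) (mu : 'rV[C]_d) c :
  W ^t* *m A *m W = diag_mx mu ->
  dotcv (A *m (W *m c)) (W *m c) = \sum_k mu 0 k * `|c k 0| ^+ 2.
Proof.
move=> WAW; rewrite dotcvE adjmxM -!mulmxA (mulmxA A) (mulmxA (W ^t*)).
rewrite (mulmxA (W ^t*)) WAW mxE; apply: eq_bigr => k _.
by rewrite mul_diag_mx !mxE normCKC mulrCA.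
Qed.

Lemma dotcv_unitary n d (W : 'M[C]_(n, d)) c :
  W ^t* *m W = 1%:M -> dotcv (W *m c) (W *m c) = \sum_k `|c k 0| ^+ 2.
Proof.
move=> WW; rewrite -{1}[W *m c]mul1mx (@dotcv_diag _ _ _ _ (const_mx 1)).
  by apply: eq_bigr => k _; rewrite mxE mul1r.
by rewrite mulmx1 WW diag_const_mx.
Qed.

Lemma dotcv_gt0 n (v : 'cV[C]_n) : v != 0 -> 0 < dotcv v v.
Proof.
move=> v0; rewrite -[v]mul1mx dotcv_unitary; last first.
  by rewrite trmx1 map_mx1 mul1mx.
rewrite lt_def sumr_ge0 ?andbT; last by move=> k _; rewrite exprn_ge0.
apply: contra v0 => /eqP /psumr_eq0P h; apply/eqP/colP => k.
have /eqP := h (fun k _ => exprn_ge0 2 (normr_ge0 _)) k isT.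
by rewrite sqrf_eq0 normr_eq0 mxE => /eqP.
Qed.

(** * Ritz bases and extremal properties of Ritz values *)

(** The eigenvectors of the compression U^H A U, mapped back by U and permuted so
that their eigenvalues decrease, form an orthonormal basis of V in which the
quadratic form of A is diagonal.  Everything below about Ritz values is read off
from the coordinates in such a basis. *)
Lemma exists_ritz_basis n (A : 'M[C]_n) (V : {vspace 'cV[C]_n}) :
  A \is hermsymmx ->
  exists W : 'M[C]_(n, \dim V),
    [/\ W ^t* *m W = 1%:M,
        forall v, v \in V <-> exists c, v = W *m c,
        W ^t* *m A *m W = diag_mx (\row_k (ritz A V)`_k),
        {in ritz A V, forall z, z \is Num.real}
      & sorted >=%R (ritz A V)].
Proof.
move=> Ah; have [U hU] := ex_orthonormal_basis_mx V.
have /andP[/eqP UU /eqP sU] := hU.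
have memU v : reflect (exists c, v = U *m c) (v \in V).
  have <- : (v \in <<[tuple col j U | j < \dim V]>>%VS) = (v \in V) by rewrite sU.
  exact: memv_span_colsP.
have rE := ritzE A hU.
set B := U ^t* *m A *m U in rE.
have Bh : B \is hermsymmx.
  apply/is_hermitianmxP; rewrite expr0 scale1r /B !adjmxM trmxCK.
  by move/is_hermitianmxP: Ah; rewrite expr0 scale1r => <-; rewrite mulmxA.
have Dr := hermitian_spectral_diag_real Bh.
have /hermitian_normalmx/orthomx_spectralP BE := Bh.
have Pu := spectral_unitarymx B.
move: BE; rewrite invmx_unitary //.
move: (spectralmx B) (spectral_diag B) Dr Pu => P D Dr /unitarymxP PP BE.
have PP' : P ^t* *m P = 1%:M by apply: mulmx1C.
pose Q := U *m P ^t*.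
have QQ : Q ^t* *m Q = 1%:M.
  by rewrite /Q adjmxM trmxCK mulmxA -(mulmxA P) UU mulmx1 PP.
have QAQ : Q ^t* *m A *m Q = diag_mx D.
  rewrite /Q adjmxM trmxCK !mulmxA -(mulmxA P) -(mulmxA P) -/B BE.
  by rewrite !mulmxA PP mul1mx -mulmxA PP mulmx1.
have memQ v : reflect (exists c, v = Q *m c) (v \in V).
  apply: (iffP (memU v)) => -[c ->]; last by exists (P ^t* *m c); rewrite mulmxA.
  by exists (P *m c); rewrite /Q mulmxA -(mulmxA U) PP' mulmx1.
have QV : orthonormal_basis_mx V Q.
  apply/andP; split; first exact/eqP.
  by apply/eqP/vspaceP => v; apply/memv_span_colsP/memQ.
(* Q is another orthonormal basis matrix of V, so the Ritz values are the *)
(* eigenvalues of its diagonal compression. *)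
have eE : perm_eq (ritz A V) [tuple D 0 k | k < \dim V].
  rewrite (ritzE A QV) QAQ; apply: prod_XsubC_eq.
  rewrite -char_poly_eigvals char_poly_trig ?diag_mx_is_trig //.
  rewrite big_map big_enum /=; apply: eq_bigr => k _.
  by rewrite mxE eqxx mulr1n.
have rR : {in ritz A V, forall z, z \is Num.real}.
  move=> z; rewrite (perm_mem eE) => /mapP[k _ ->].
  by have /mxOverP := Dr; apply.
have [s sE] := tuple_permP eE.
exists (colsub s Q); split=> //.
- apply/matrixP => a b.
  have := congr1 (fun M : 'M_ _ => M (s a) (s b)) QQ; rewrite !mxE.
  rewrite (inj_eq perm_inj) => <-.
  by apply: eq_bigr => k _; rewrite !mxE.
- move=> v; split=> [/memQ[c ->] | [c ->]].
    exists (\col_k c (s k) 0); apply/colP => a; rewrite !mxE.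
    by rewrite (reindex_perm s) /=; apply: eq_bigr => k _; rewrite !mxE.
  apply/memQ; exists (\col_k c ((s^-1)%g k) 0); apply/colP => a; rewrite !mxE.
  rewrite [RHS](reindex_perm s) /=; apply: eq_bigr => k _.
  by rewrite !mxE permK.
- apply/matrixP => a b.
  have := congr1 (fun M : 'M_ _ => M (s a) (s b)) QAQ; rewrite !mxE.
  rewrite (inj_eq perm_inj) sE -tnth_nth !tnth_mktuple => <-.
  apply: eq_bigr => k _; rewrite !mxE; congr (_ * _).
  by apply: eq_bigr => j _; rewrite !mxE.
- rewrite /ritz; apply: (@sort_sorted_in _ Num.real).
    by move=> z w zr wr; rewrite orbC; exact: real_leVge.
  apply/allP => z; move: (rR z); rewrite /ritz /eigvals mem_sort; exact.
Qed.

Lemma ritz_val_real n (A : 'M[C]_n) (V : {vspace 'cV[C]_n}) i :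
  A \is hermsymmx -> ritz_val A V i \is Num.real.
Proof.
move=> /(exists_ritz_basis V)[W [_ _ _ rR _]]; rewrite /ritz_val.
have [lt_i|ge_i] := ltnP i.-1 (size (ritz A V)); first exact/rR/mem_nth.
by rewrite nth_default // real0.
Qed.

(** Each row of M is one linear condition, and lowers the dimension by at most
one. *)
Lemma dim_cap_lker_mulmx n m (V : {vspace 'cV[C]_n}) (M : 'M[C]_(m, n)) :
  (\dim V - m <= \dim (V :&: lker (linfun (mulmx M : 'cV[C]_n -> 'cV[C]_m))))%N.
Proof.
rewrite -(limg_ker_dim (linfun (mulmx M : 'cV[C]_n -> 'cV[C]_m)) V).
rewrite leq_subLR [leqRHS]addnC leq_add2l.
by have := dimvS (subvf (linfun (mulmx M : 'cV[C]_n -> 'cV[C]_m) @: V));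
   rewrite dimvf /dim /= muln1.
Qed.

(** The half of the Courant-Fischer principle that is needed here.  With
i = dim W, the i - 1 conditions that the first i - 1 coordinates in a Ritz basis
of V vanish leave a nonzero vector in W; only the Ritz values from the ith largest
on contribute to its Rayleigh quotient.  For W = V it says that the smallest Ritz
value is an upper bound of some Rayleigh quotient in V. *)
Lemma ritz_val_min_le n (A : 'M[C]_n) (V W : {vspace 'cV[C]_n}) :
  A \is hermsymmx -> (W <= V)%VS -> (0 < \dim W)%N ->
  exists v, [/\ v \in W, v != 0 &
    dotcv (A *m v) v <= ritz_val A V (\dim W) * dotcv v v].
Proof.
move=> Ah sWV; set i := \dim W => i_gt0.
have le_iV : (i <= \dim V)%N by apply: dimvS.
have [B [BB memB BAB rR srt]] := exists_ritz_basis V Ah.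
have le_i1 : (i.-1 <= \dim V)%N by rewrite (leq_trans (leq_pred _)).
(* The rows of M are the conjugates of the first i - 1 Ritz vectors. *)
pose M := rowsub (widen_ord le_i1) (B ^t*).
pose K := (W :&: lker (linfun (mulmx M : 'cV[C]_n -> 'cV[C]__)))%VS.
have K0 : K != 0%VS.
  rewrite -dimv_eq0 -lt0n; apply: leq_trans (dim_cap_lker_mulmx W M).
  by rewrite subn_gt0 prednK.
have : vpick K \in K by apply: memv_pick.
rewrite memv_cap memv_ker lfunE /= => /andP[vW /eqP Mv].
exists (vpick K); split; rewrite ?vpick0 //.
have /memB[c vE] := subvP sWV _ vW.
have c0 (k : 'I_(\dim V)) : (k < i.-1)%N -> c k 0 = 0.
  move=> lt_k; have := congr1 (fun u : 'cV_ _ => u (Ordinal lt_k) 0) Mv.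
  rewrite vE /M mul_rowsub_mx mulmxA BB mul1mx !mxE => <-.
  by congr (c _ _); apply: val_inj.
rewrite vE (dotcv_diag _ BAB) dotcv_unitary // mulr_sumr; apply: ler_sum => k _.
have [/c0-> | le_k] := ltnP k i.-1; first by rewrite normr0 expr0n /= !mulr0.
rewrite ler_wpM2r ?exprn_ge0 // mxE /ritz_val.
apply: (@sorted_leq_nth _ >=%R); rewrite ?inE ?size_ritz //.
- by move=> y x z le_yx le_zy; apply: le_trans le_yx.
- exact: lexx.
- by rewrite prednK.
Qed.

Lemma ritz_val_last_le n (A : 'M[C]_n) (V : {vspace 'cV[C]_n}) v :
  A \is hermsymmx -> v \in V ->
  ritz_val A V (\dim V) * dotcv v v <= dotcv (A *m v) v.
Proof.
move=> Ah; have [B [BB memB BAB rR srt]] := exists_ritz_basis V Ah.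
move=> /memB[c ->]; rewrite (dotcv_diag _ BAB) dotcv_unitary // mulr_sumr.
apply: ler_sum => k _; rewrite ler_wpM2r ?exprn_ge0 // mxE /ritz_val.
have d_gt0 : (0 < \dim V)%N by apply: leq_ltn_trans (ltn_ord k).
apply: (@sorted_leq_nth _ >=%R); rewrite ?inE ?size_ritz ?ltn_predL //.
- by move=> y x z le_yx le_zy; apply: le_trans le_yx.
- exact: lexx.
- by rewrite -ltnS prednK.
Qed.

(** * Two facts on the order of a numeric closed field *)

(** The order is only partial, but norms are comparable, so their iterated maximum
still dominates them. *)
Lemma le_bigmax_norm (I : eqType) (r : seq I) (g : I -> C) :
  0 <= \big[Num.max/0]_(j <- r) `|g j| /\
  {in r, forall j, `|g j| <= \big[Num.max/0]_(j <- r) `|g j|}.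
Proof.
elim: r => [|a r [ge0 ler]]; first by rewrite big_nil.
rewrite big_cons; set m := \big[_/_]_(_ <- _) _ in ge0 ler *.
have cmp : `|g a| >=< m by apply: real_comparable; rewrite ?normr_real ?ger0_real.
split; first by rewrite comparable_le_max // ge0 orbT.
move=> j; rewrite inE comparable_le_max // => /orP[/eqP->|/ler->].
  by rewrite lexx.
by rewrite orbT.
Qed.

(** The quotient of the two comparisons.  The second one forces l1 < eta, so all
the denominators are positive. *)
Lemma gap_ratio_le (l l1 kap eta m F N D : C) :
  0 < N -> 0 < D -> 0 < F -> l1 < kap -> eta < l ->
  (l - eta) * N <= m * ((l - kap) * D) ->
  F * ((kap - l1) * D) <= (eta - l1) * N ->
  0 < (l - eta) / (eta - l1) <= m / F * ((l - kap) / (kap - l1)).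
Proof.
move=> N0 D0 F0 kap_gt eta_lt up low.
have k0 : 0 < kap - l1 by rewrite subr_gt0.
have e0 : 0 < eta - l1.
  by rewrite -(pmulr_lgt0 _ N0) (lt_le_trans _ low) // !mulr_gt0.
have h0 : 0 < l - eta by rewrite subr_gt0.
rewrite divr_gt0 //= mulf_div ler_pdivrMr // mulrAC ler_pdivlMr ?mulr_gt0 //.
rewrite -(ler_pM2r (mulr_gt0 N0 D0)).
have -> : (l - eta) * (F * (kap - l1)) * (N * D)
        = ((l - eta) * N) * (F * ((kap - l1) * D)).
  by ring.
have -> : m * (l - kap) * (eta - l1) * (N * D)
        = (m * ((l - kap) * D)) * ((eta - l1) * N).
  by ring.
by apply: ler_pM; rewrite // ltW // !mulr_gt0.
Qed.

(** * The orthonormal eigenbasis as a unitary matrix *)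

Lemma pair_ortho_recE n (s : seq 'cV[C]_n) :
  pair_ortho_rec (@dotcv C n) s = pairwise (fun u v => dotcv u v == 0) s.
Proof. by elim: s => //= u s ->; rewrite andbT. Qed.

Lemma orthonormal_nth n (s : seq 'cV[C]_n) j k :
  orthonormal (@dotcv C n) s -> (j < size s)%N -> (k < size s)%N ->
  dotcv s`_j s`_k = (j == k)%:R.
Proof.
move=> /andP[/allP s1]; rewrite pair_ortho_recE => /(pairwiseP 0) so lt_j lt_k.
case: (ltngtP j k) => [lt_jk|lt_kj|->]; first by apply/eqP/so.
  by apply/eqP; rewrite herm_eq0C; apply: so.
exact/eqP/s1/mem_nth.
Qed.

Lemma eigenbasis_mx n (A : 'M[C]_n) (lam : nat -> C) (x : nat -> 'cV[C]_n) :
  orthonormal (@dotcv C n) [seq x j | j <- index_iota 1 n.+1] ->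
  (forall j, (1 <= j <= n)%N -> A *m x j = lam j *: x j) ->
  let X := \matrix_(a, k) x k.+1 a 0 : 'M[C]_n in
  [/\ X ^t* *m X = 1%:M,
      X ^t* *m A *m X = diag_mx (\row_k lam k.+1)
    & forall f : C -> C,
        \sum_(1 <= j < n.+1) f (lam j) *: (x j *m (x j) ^t*)
        = X *m diag_mx (\row_k f (lam k.+1)) *m X ^t*].
Proof.
move=> ox xe X.
have sz : size [seq x j | j <- index_iota 1 n.+1] = n.
  by rewrite size_map size_iota subn1.
have dx (j k : 'I_n) : dotcv (x j.+1) (x k.+1) = (j == k)%:R.
  have := orthonormal_nth ox; rewrite sz => /(_ j k (ltn_ord j) (ltn_ord k)).
  by rewrite !(nth_map 0%N) ?size_iota ?subn1 // !nth_iota ?subn1 // !add1n.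
have colX k : col k X = x k.+1 by apply/colP => a; rewrite !mxE.
have XX : X ^t* *m X = 1%:M.
  apply/matrixP => j k; transitivity ((X ^t* *m col k X) j 0).
    by rewrite !mxE; apply: eq_bigr => a _; rewrite !mxE.
  by rewrite dotcv_cols !colX dx mxE eq_sym.
have AX : A *m X = X *m diag_mx (\row_k lam k.+1).
  apply/matrixP => a k; transitivity ((A *m x k.+1) a 0).
    by rewrite !mxE; apply: eq_bigr => b _; rewrite mxE.
  by rewrite mul_mx_diag xe ?ltn_ord // !mxE mulrC.
split=> // [|f]; first by rewrite -mulmxA AX mulmxA XX mul1mx.
rewrite big_add1 big_mkord mul_mx_diag; apply/matrixP => a b.
rewrite summxE !mxE; apply: eq_bigr => k _.
by rewrite !mxE big_ord1 !mxE mulrA [f _ * _]mulrC.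
Qed.

(** * Comparison of quadratic forms before and after the filter *)

Section EigenBasis.
Variables (n : nat) (A X : 'M[C]_n) (mu : 'rV[C]_n).
Hypotheses (XX : X ^t* *m X = 1%:M) (XAX : X ^t* *m A *m X = diag_mx mu).

Lemma dotcv_shift_eigen z c :
  dotcv (A *m (X *m c)) (X *m c) - z * dotcv (X *m c) (X *m c)
  = \sum_k (mu 0 k - z) * `|c k 0| ^+ 2.
Proof.
rewrite (dotcv_diag _ XAX) dotcv_unitary // mulr_sumr -sumrB.
by apply: eq_bigr => k _; rewrite mulrBl.
Qed.

Variable g : 'rV[C]_n.
Let H := X *m diag_mx g *m X ^t*.

(** Termwise comparison of the two diagonal sums.  The hypothesis on |g_k|^2 is an
upper or a lower bound by w according to the sign of mu_k - z, and it is only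
asked on the eigenvectors that occur in v. *)
Lemma shifted_form_amplified w z v :
  (forall k, (X ^t* *m v) k 0 != 0 ->
     w * (mu 0 k - z) <= `|g 0 k| ^+ 2 * (mu 0 k - z)) ->
  w * (dotcv (A *m v) v - z * dotcv v v)
    <= dotcv (A *m (H *m v)) (H *m v) - z * dotcv (H *m v) (H *m v).
Proof.
set c := X ^t* *m v => hw.
have vE : v = X *m c by rewrite mulmxA (mulmx1C XX) mul1mx.
have -> : H *m v = X *m (diag_mx g *m c) by rewrite /H -!mulmxA.
rewrite {1 2 3 4}vE !dotcv_shift_eigen mulr_sumr; apply: ler_sum => k _.
have -> : (diag_mx g *m c) k 0 = g 0 k * c k 0 by rewrite mul_diag_mx mxE.
have [->|/hw le_w] := eqVneq (c k 0) 0; first by rewrite mulr0 normr0 expr0n !mulr0.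
by rewrite normrM exprMn mulrA [leRHS]mulrCA mulrA ler_wpM2r ?exprn_ge0.
Qed.

(** A kernel vector of H in V would have shifted form zero after the filter, while
the form is positive before it and the filter amplifies it. *)
Lemma dim_filtered_image (V : {vspace 'cV[C]_n}) (l1 F : C) :
  0 < F ->
  (forall k, l1 <= mu 0 k /\ F <= `|g 0 k| \/ mu 0 k <= l1 /\ `|g 0 k| <= F) ->
  (forall v, v \in V -> v != 0 -> 0 < dotcv (A *m v) v - l1 * dotcv v v) ->
  \dim (mximg H V) = \dim V.
Proof.
move=> F0 hk hV; apply: limg_dim_eq; apply/eqP; rewrite -vpick0.
set v := vpick _; have : v \in (V :&: lker (linfun (mulmx H)))%VS by apply: memv_pick.
rewrite memv_cap memv_ker lfunE /= => /andP[vV /eqP Hv].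
apply: contraT => /(hV v vV) pos.
have /(shifted_form_amplified (w := F ^+ 2) (z := l1)) : forall k, (X ^t* *m v) k 0 != 0 ->
     F ^+ 2 * (mu 0 k - l1) <= `|g 0 k| ^+ 2 * (mu 0 k - l1).
  move=> k _; case: (hk k) => -[le_mu le_g].
    by rewrite ler_wpM2r ?subr_ge0 // lerXn2r ?nnegrE // ltW.
  by rewrite ler_wnM2r ?subr_le0 // lerXn2r ?nnegrE // ltW.
rewrite Hv mulmx0 linear0l mulr0 subr0 => /(lt_le_trans (mulr_gt0 _ pos)).
by rewrite ltxx => ->; rewrite ?exprn_gt0.
Qed.

(** The central estimate.  Letting V be any subspace containing H W, and kap any
lower bound of the Rayleigh quotients in W, covers at once the Ritz values in
f(A) Ytilde_i and those in f(A) Y. *)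
Lemma filtered_ritz_bound (V W : {vspace 'cV[C]_n}) (l l1 kap m F : C) :
  A \is hermsymmx -> l \is Num.real -> 0 < F -> 0 <= m <= F -> l1 <= l -> l1 < kap ->
  (0 < \dim W)%N -> \dim (mximg H W) = \dim W -> (mximg H W <= V)%VS ->
  (forall v k, v \in W -> (X ^t* *m v) k 0 != 0 ->
     l <= mu 0 k /\ F <= `|g 0 k| \/ mu 0 k <= l1 /\ `|g 0 k| <= m) ->
  (forall v, v \in W -> kap * dotcv v v <= dotcv (A *m v) v) ->
  let eta := ritz_val A V (\dim W) in
  eta >= l \/
  0 < (l - eta) / (eta - l1) <= m ^+ 2 / F ^+ 2 * ((l - kap) / (kap - l1)).
Proof.
move=> Ah lr F0 /andP[m0 le_mF] le_l kap_gt W0 dW sWV split_W kap_le eta.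
have er : eta \is Num.real by apply: ritz_val_real.
have [|eta_lt] := real_leP lr er; [by left | right].
have [|_ [/memv_imgP[v vW ->] ]] := ritz_val_min_le Ah sWV; first by rewrite dW.
rewrite dW -/eta lfunE /= => Hv0 eta_ge.
have v0 : v != 0 by apply: contra Hv0 => /eqP->; rewrite mulmx0.
have N0 := dotcv_gt0 Hv0; have D0 := dotcv_gt0 v0.
have up : m ^+ 2 * (dotcv (A *m v) v - l * dotcv v v)
    <= dotcv (A *m (H *m v)) (H *m v) - l * dotcv (H *m v) (H *m v).
  apply: shifted_form_amplified => k /(split_W v k vW)[[le_mu le_g]|[le_mu le_g]].
    rewrite ler_wpM2r ?subr_ge0 // lerXn2r ?nnegrE //.
    exact: le_trans le_g.
  by rewrite ler_wnM2r ?subr_le0 ?(le_trans le_mu) // lerXn2r ?nnegrE.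
have low : F ^+ 2 * (dotcv (A *m v) v - l1 * dotcv v v)
    <= dotcv (A *m (H *m v)) (H *m v) - l1 * dotcv (H *m v) (H *m v).
  apply: shifted_form_amplified => k /(split_W v k vW)[[le_mu le_g]|[le_mu le_g]].
    rewrite ler_wpM2r ?subr_ge0 ?(le_trans le_l) // lerXn2r ?nnegrE //.
    exact: ltW.
  rewrite ler_wnM2r ?subr_le0 // lerXn2r ?nnegrE ?(ltW F0) //.
  exact: le_trans le_g le_mF.
apply: (gap_ratio_le N0 D0); rewrite ?exprn_gt0 //.
  have -> : (l - kap) * dotcv v v = - (kap * dotcv v v - l * dotcv v v) by ring.
  rewrite mulrN mulrBl lerNr opprB; apply: le_trans (lerB eta_ge (lexx _)).
  apply: le_trans up; rewrite ler_wpM2l ?exprn_ge0 // lerD2r; exact: kap_le.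
rewrite mulrBl [leRHS]mulrBl; apply: le_trans (lerB eta_ge (lexx _)).
apply: le_trans low; rewrite ler_wpM2l ?exprn_ge0 ?(ltW F0) // lerD2r.
exact: kap_le.
Qed.

End EigenBasis.
End RitzFilter.

(** * The bounds for complex Hermitian matrices *)

Local Open Scope complex_scope.

Theorem theorem3p4 (R : realType) (n : nat) (A : 'M[R[i]]_n)
    (lam : nat -> R[i]) (x : nat -> 'cV[R[i]]_n)
    (Y : {vspace 'cV[R[i]]_n}) (f : R[i] -> R[i]) (p t i : nat)
    (A_herm : A \is hermsymmx)
    (lam_ge : forall j k, (1 <= j <= k)%N -> (k <= n)%N -> lam k <= lam j)
    (x_eig : forall j, (1 <= j <= n)%N -> A *m x j = lam j *: x j)
    (x_orthonormal : orthonormal (@dotcv R[i] n) [seq x j | j <- index_iota 1 n.+1])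
    (p_dim : p = \dim Y) (p_ge1 : (1 <= p)%N)
    (t_range : (p <= t <= n - 1)%N) (i_range : (1 <= i <= p)%N) :
  let fA := \sum_(1 <= j < n.+1) f (lam j) *: (x j *m (x j) ^t*) in
  let maxf := \big[Num.max/0]_(t.+1 <= j < n.+1) `|f (lam j)| in
  let Y' := mximg fA Y in
  let Xt := orthov (@dotcv R[i] n)
              <<[seq x j | j <- index_iota (t - p + i).+1 t.+1]>>%VS in
  let Yt := (Xt :&: Y)%VS in
  let l := lam (t - p + i)%N in
  let l1 := lam t.+1 in
  let eta_p := ritz_val A Y p in
  eta_p > l1 ->
  (forall j k, (1 <= j <= k)%N -> (k <= t)%N ->
     `|f (lam k)| <= `|f (lam j)|) ->
  `|f (lam t)| > maxf ->
  [/\ (\dim Yt >= i)%N,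
      forall Yi : {vspace 'cV[R[i]]_n}, (Yi <= Yt)%VS -> \dim Yi = i ->
        let Yi' := mximg fA Yi in
        \dim Yi' = i /\
        (let eta := ritz_val A Yi i in
         let eta' := ritz_val A Yi' i in
         eta' >= l \/
         0 < (l - eta') / (eta' - l1)
           <= maxf ^+ 2 / `|f l| ^+ 2 * ((l - eta) / (eta - l1))),
      \dim Y' = p
    & let eta' := ritz_val A Y' i in
      eta' >= l \/
      0 < (l - eta') / (eta' - l1)
        <= maxf ^+ 2 / `|f l| ^+ 2 * ((l - eta_p) / (eta_p - l1))].
Proof.
move=> fA maxf Y' Xt Yt l l1 eta_p eta_p_gt f_ge f_gap.
have [XX XAX fAE] := eigenbasis_mx x_orthonormal x_eig.
set X := \matrix_(_, _) _ in XX XAX fAE.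
case/andP: t_range => le_pt le_tn; case/andP: i_range => i_gt0 le_ip.
set s := (t - p + i)%N in Xt Yt l *.
have [s_gt0 le_st] : (0 < s)%N /\ (s <= t)%N by rewrite /s; lia.
have lt_tn : (t < n)%N by lia.
have [maxf_ge0 maxf_le] := le_bigmax_norm (index_iota t.+1 n.+1) (f \o lam).
rewrite -/maxf in maxf_ge0 maxf_le.
have {}maxf_le k : (t < k <= n)%N -> `|f (lam k)| <= maxf.
  by move=> k_range; apply: maxf_le; rewrite mem_index_iota.
have ft_gt0 : 0 < `|f (lam t)| by apply: le_lt_trans f_gap.
have le_fts : `|f (lam t)| <= `|f l| by apply: f_ge; rewrite ?s_gt0 ?leqnn.
have fl_gt0 : 0 < `|f l| by apply: lt_le_trans le_fts.
have le_l1 : l1 <= l by apply: lam_ge; rewrite ?s_gt0 //= ltnW.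
(* l, l1 and eta_p are comparable, so the reality of eta_p spreads to l. *)
have l_real : l \is Num.real.
  rewrite (ger_real le_l1) -(ger_real (ltW eta_p_gt)).
  exact: ritz_val_real.
have Y_ge v : v \in Y -> eta_p * dotcv v v <= dotcv (A *m v) v.
  by move=> vY; rewrite /eta_p p_dim; apply: ritz_val_last_le.
have Y_gt v : v \in Y -> v != 0 -> 0 < dotcv (A *m v) v - l1 * dotcv v v.
  move=> vY v0; rewrite subr_gt0; apply: lt_le_trans (Y_ge v vY).
  by rewrite ltr_pM2r // dotcv_gt0.
have dim_img V : (V <= Y)%VS -> \dim (mximg fA V) = \dim V.
  move=> sVY; rewrite /fA fAE.
  apply: (dim_filtered_image XX XAX (l1 := l1) ft_gt0) => [k|v /(subvP sVY)].
    rewrite !mxE; have [lt_kt|le_tk] := ltnP k t; [left|right].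
      by split; [apply: lam_ge; rewrite //= ltnS ltnW | apply: f_ge].
    split; first by apply: lam_ge; rewrite ?ltn_ord.
    by apply: le_trans (ltW f_gap); apply: maxf_le; rewrite ltnS le_tk ltn_ord.
  exact: Y_gt.
have dim_Yt : (i <= \dim Yt)%N.
  (* The t - s = p - i rows of M are the conjugates of x_(s+1), ..., x_t. *)
  pose M := \matrix_(k < (t - s)%N, a < n) (x (s + k).+1 a 0)^*.
  apply: (@leq_trans (\dim (Y :&: lker (linfun (mulmx M : 'cV_n -> 'cV__))))).
    apply: leq_trans (dim_cap_lker_mulmx Y M); rewrite -p_dim /s; lia.
  apply: dimvS; rewrite /Yt capvC capvS //; apply/subvP => v.
  rewrite memv_ker lfunE /= => /eqP Mv; rewrite mem_orthov_sym.
  apply/span_subvP => _ /mapP[j j_range ->].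
  rewrite mem_orthov1 herm_eq0C; apply/eqP.
  transitivity (((x j) ^t* *m v) 0 0); first exact: dotcvE.
  move: j_range; rewrite mem_index_iota ltnS => /andP[lt_sj le_jt].
  have lt_k : (j - s.+1 < t - s)%N by rewrite ltn_subLR // addSn subnKC.
  have := congr1 (fun u : 'cV_(t - s) => u (Ordinal lt_k) 0) Mv.
  rewrite !mxE /= => Mv0; rewrite -[RHS]Mv0.
  by apply: eq_bigr => a _; rewrite !mxE -addSn subnKC.
have split_Yt v k : v \in Yt -> (X ^t* *m v) k 0 != 0 ->
    l <= (\row_k lam k.+1) 0 k /\ `|f l| <= `|(\row_k f (lam k.+1)) 0 k| \/
    (\row_k lam k.+1) 0 k <= l1 /\ `|(\row_k f (lam k.+1)) 0 k| <= maxf.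
  rewrite memv_cap => /andP[/mem_orthovP vXt _]; rewrite dotcv_cols !mxE.
  have -> : col k X = x k.+1 by apply/colP => a; rewrite !mxE.
  move=> ck0; have [lt_ks|le_sk] := ltnP k s; [left|right].
    by split; [apply: lam_ge; rewrite // (leq_trans le_st) ?(ltnW lt_tn) | apply: f_ge].
  have le_tk : (t <= k)%N.
    rewrite leqNgt; apply: contra ck0 => lt_kt; apply/eqP/vXt/memv_span.
    by apply: map_f; rewrite mem_index_iota ltnS le_sk.
  split; first by apply: lam_ge; rewrite ?ltn_ord.
  by apply: maxf_le; rewrite ltnS le_tk ltn_ord.
have bound (V W : {vspace 'cV[R[i]]_n}) kap : (W <= Yt)%VS -> \dim W = i ->
    (mximg fA W <= V)%VS -> l1 < kap ->
    (forall v, v \in W -> kap * dotcv v v <= dotcv (A *m v) v) ->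
    let eta := ritz_val A V i in
    eta >= l \/ 0 < (l - eta) / (eta - l1)
      <= maxf ^+ 2 / `|f l| ^+ 2 * ((l - kap) / (kap - l1)).
  move=> sWY dW sWV kap_gt kap_le; rewrite -dW.
  have sWY' := subv_trans sWY (capvSr _ _).
  have dfW := dim_img W sWY'; rewrite /fA fAE in sWV dfW.
  apply: (filtered_ritz_bound XX XAX A_herm l_real fl_gt0 _ _ _ _ dfW sWV) => //.
  - by rewrite maxf_ge0 (le_trans (ltW f_gap)).
  - by rewrite dW.
  - by move=> v k vW; apply/split_Yt/(subvP sWY).
split=> //.
- move=> Yi sYi dYi Yi'.
  have sYiY := subv_trans sYi (capvSr _ _).
  split; first by rewrite /Yi' dim_img.
  move=> eta eta'.
  apply: (bound _ _ _ sYi) => // [|v]; last first.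
    by rewrite /eta -dYi; apply: ritz_val_last_le.
  have [|v [vY v0]] := ritz_val_min_le A_herm (subvv Yi); first by rewrite dYi.
  rewrite dYi -/eta => le_eta; rewrite -(ltr_pM2r (dotcv_gt0 v0)).
  apply: lt_le_trans le_eta; rewrite -subr_gt0; apply: Y_gt => //.
  exact: (subvP sYiY).
- by rewrite /Y' dim_img.
- move=> eta'.
  have [Yi sYi dYi] : exists2 Yi : {vspace 'cV[R[i]]_n}, (Yi <= Yt)%VS & \dim Yi = i.
    exists <<take i (vbasis Yt)>>%VS.
      by apply/span_subvP => v /mem_take; apply: vbasis_mem.
    have /catl_free : free (take i (vbasis Yt) ++ drop i (vbasis Yt)).
      by rewrite cat_take_drop; apply: basis_free (vbasisP Yt).
    by move=> /eqP->; rewrite size_takel // size_tuple.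
  have sYiY := subv_trans sYi (capvSr _ _).
  apply: (bound _ _ _ sYi dYi) => //; first exact: limgS.
  by move=> v /(subvP sYiY); apply: Y_ge.
Qed.
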